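(* For a lattice-ordered semiring $R$ the following statements are equivalent: (i) $R$ is congruence-simple; (ii) $R$ is simple; (iii) $R\cong\mathbf{B}$.
   Context: A semiring $(R,+,\cdot,0,1)$ consists of a commutative monoid $(R,+,0)$ and a monoid $(R,\cdot,1)$ such that multiplication distributes over addition on both sides and $0r=0=r0$ for all $r\in R$. An ideal is an additive submonoid closed under left and right multiplication by elements of $R$. $R$ is ideal-simple if $0$ and $R$ are its only ideals; congruence-simple if the diagonal and $R^2$ are its only congruences; simple if it is both. $R$ is lattice-ordered if there is also a lattice structure $(R,\vee,\wedge)$ on $R$ such that $a+b=a\vee b$ and $ab\le a\wedge b$ for all $a,b\in R$, where $\le$ is the partial order naturally induced by the lattice operations. $\mathbf{B}=\{0,1\}$ is the Boolean semifield ($1+1=1$).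
   Formalization: The semiring R is required to satisfy 0 ≠ 1, since the one-element semiring satisfies (i) and (ii) but not (iii); R is also taken with decidable equality and order and a choice operator, which classical logic with choice supplies for every R. *)

(* Defs.v *)
From HB Require Import structures.
From mathcomp Require Import all_boot all_order ssralg.
From Stdlib Require Import RelationClasses.

Set Implicit Arguments.
Unset Strict Implicit.
Unset Printing Implicit Defensive.

Import Order.TTheory GRing.Theory.
Local Open Scope ring_scope.

(* Semirings are assumed to satisfy 0 != 1 (nzSemiRingType): in the trivial
   semiring the diagonal and the full relation are the only congruences, yet it
   is not isomorphic to the Boolean semifield. Multiplication need not commute. *)

HB.mixin Record isLatticeOrdered (d : Order.disp_t) R
    of GRing.NzSemiRing R & Order.Lattice d R := {
  addr_join : forall a b : R, a + b = (a `|` b)%O;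
  mulr_le_meet : forall a b : R, (a * b <= a `&` b)%O
}.

(* ssrnum must not be loaded here: Hierarchy Builder rejects this join after the
   ordered Z-modules have been declared. *)
#[short(type="latticeOrderedSemiRingType")]
HB.structure Definition LatticeOrderedSemiRing (d : Order.disp_t) :=
  {R of GRing.NzSemiRing R & Order.Lattice d R & isLatticeOrdered d R}.

Record semiring_ideal (R : nzSemiRingType) (I : R -> Prop) : Prop := {
  ideal0 : I 0;
  idealD : forall x y, I x -> I y -> I (x + y);
  idealMl : forall r x, I x -> I (r * x);
  idealMr : forall r x, I x -> I (x * r)
}.

Record semiring_congruence (R : nzSemiRingType) (r : R -> R -> Prop) : Prop := {
  congr_equiv : Equivalence r;
  congrD : forall x x' y y', r x x' -> r y y' -> r (x + y) (x' + y');
  congrM : forall x x' y y', r x x' -> r y y' -> r (x * y) (x' * y')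
}.

Definition ideal_simple (R : nzSemiRingType) : Prop :=
  forall I : R -> Prop, semiring_ideal I ->
    (forall x, I x <-> x = 0) \/ (forall x, I x).

Definition congruence_simple (R : nzSemiRingType) : Prop :=
  forall r : R -> R -> Prop, semiring_congruence r ->
    (forall x y, r x y <-> x = y) \/ (forall x y, r x y).

Definition simple_semiring (R : nzSemiRingType) : Prop :=
  ideal_simple R /\ congruence_simple R.

(* The canonical ring structure on bool is F_2 (addition is xor), so the
   Boolean semifield lives on an alias, with addition || and product &&. *)
Definition boolean_semifield : Type := bool.
HB.instance Definition _ := Finite.copy boolean_semifield bool.
HB.instance Definition _ :=
  GRing.isNmodule.Build boolean_semifield orbA orbC orFb.
HB.instance Definition _ :=
  GRing.Nmodule_isComNzSemiRing.Build boolean_semifield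
    andbA andbC andTb andb_orl andFb isT.

Definition semiring_isomorphic (R S : nzSemiRingType) : Prop :=
  exists f : {rmorphism R -> S}, bijective f.

(* Main.v *)
Require Import Defs.
From HB Require Import structures.
From mathcomp Require Import all_boot all_order ssralg.
From Stdlib Require Import Classical_Prop.

(** In a lattice-ordered semiring 0 is the bottom and 1 the top, and for each
    [a] the relation [x + a = y + a] is a congruence, because [a * z] and
    [z * a] lie below [a]. It identifies [a] with 0, so in a congruence-simple
    semiring it is full as soon as [a <> 0]; then [a = 1 + a = 1]. Hence such a
    semiring is {0, 1}. *)

Set Implicit Arguments.
Unset Strict Implicit.
Unset Printing Implicit Defensive.

Import Order.TTheory GRing.Theory.
Local Open Scope ring_scope.

Section LatticeOrdered.
Variables (d : Order.disp_t) (R : latticeOrderedSemiRingType d).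
Implicit Types a x y : R.

Lemma addrr_id x : x + x = x.
Proof. by rewrite addr_join joinxx. Qed.

Lemma addr_mull_absorb a x : x * a + a = a.
Proof.
rewrite addr_join; apply/join_idPr/(le_trans (mulr_le_meet x a)).
exact: leIr.
Qed.

Lemma addr_mulr_absorb a x : a * x + a = a.
Proof.
rewrite addr_join; apply/join_idPr/(le_trans (mulr_le_meet a x)).
exact: leIl.
Qed.

Lemma addr1_top x : 1 + x = 1.
Proof. by rewrite addrC -{1}[x]mulr1 addr_mull_absorb. Qed.

Lemma shift_congruence a : semiring_congruence (fun x y => x + a = y + a).
Proof.
split.
- split=> [x | x y -> | x y z -> ->] //.
- move=> x x' y y' xx' yy'.
  (* Writing [a] as [a + a] gives each summand its own copy:
     [(x + y) + (a + a) = (x + a) + (y + a)]. *)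
  by rewrite -[a]addrr_id addrACA xx' yy' addrACA.
have mull z x x' : x + a = x' + a -> z * x + a = z * x' + a.
  (* Expanding [a] to [z * a + a] turns [z * x + a] into [z * (x + a) + a], where the hypothesis
     applies. *)
  move=> xx'; rewrite -(addr_mull_absorb a z) !addrA -!mulrDr.
  by rewrite xx'.
have mulr z x x' : x + a = x' + a -> x * z + a = x' * z + a.
  move=> xx'; rewrite -(addr_mulr_absorb a z) !addrA -!mulrDl.
  by rewrite xx'.
(* One factor is changed at a time, passing through [x' * y]. *)
by move=> x x' y y' xx' yy'; rewrite (mulr y x x' xx') (mull x' y y' yy').
Qed.

Lemma congruence_simple_two_elements :
  congruence_simple R -> forall x, x = 0 \/ x = 1.
Proof.
move=> simR a; have [eq_r | full_r] := simR _ (shift_congruence a).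
  by left; apply/eq_r; rewrite addrr_id add0r.
by right; have := full_r 1 0; rewrite addr1_top add0r.
Qed.

End LatticeOrdered.

Section TwoElements.
Variable R : nzSemiRingType.
Hypothesis R01 : forall x : R, x = 0 \/ x = 1.

(** An ideal containing 1 is everything, and one missing 1 has only 0 left. As [I] is an arbitrary
    predicate, the case split is classical. *)
Lemma two_elements_ideal_simple : ideal_simple R.
Proof.
move=> I idI; have [I1 | nI1] := classic (I 1).
  by right=> x; rewrite -[x]mulr1; apply: idealMl.
left=> x; split=> [Ix | ->]; last exact: ideal0.
by have [// | x1] := R01 x; rewrite x1 in Ix.
Qed.

(** By reflexivity and symmetry, a congruence is determined by whether it relates 0 to 1. *)
Lemma two_elements_congruence_simple : congruence_simple R.
Proof.
move=> r [[rxx rC _] _ _]; have [r01 | nr01] := classic (r 0 1).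
  right=> x y; have [-> | ->] := R01 x; have [-> | ->] := R01 y => //.
  exact: rC.
left=> x y; split=> [| -> //].
have [-> | ->] := R01 x; have [-> | ->] := R01 y => // r10.
by case: nr01; apply: rC.
Qed.

(** The condition [1 + 1 = 1] excludes the field with two elements, where [1 + 1 = 0]. The
    isomorphism is the test for being nonzero. *)
Lemma two_elements_isomorphic :
  1 + 1 = 1 :> R -> semiring_isomorphic R boolean_semifield.
Proof.
move=> add11; pose f (x : R) : boolean_semifield := x != 0.
have n10 : (1 : R) != 0 := oner_neq0 R.
have f_additive : nmod_morphism f.
  split=> [|x y]; first by rewrite /f eqxx.
  by rewrite /f; have [-> | ->] := R01 x; have [-> | ->] := R01 y;
    rewrite ?add11 ?addr0 ?add0r ?eqxx ?n10.
have f_multiplicative : monoid_morphism f.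
  split=> [|x y]; first by rewrite /f n10.
  by rewrite /f; have [-> | ->] := R01 x; have [-> | ->] := R01 y;
    rewrite ?mulr0 ?mul0r ?mulr1 ?eqxx ?n10.
pose fA := GRing.isNmodMorphism.Build _ _ f f_additive.
pose fM := GRing.isMonoidMorphism.Build _ _ f f_multiplicative.
pose F : {rmorphism R -> boolean_semifield} := HB.pack f fA fM.
exists F; exists (fun b : boolean_semifield => if b then 1 else 0).
  by move=> x; rewrite /= /f; have [-> | ->] := R01 x; rewrite ?eqxx ?n10.
by case; rewrite /= /f ?eqxx ?n10.
Qed.

End TwoElements.

Lemma isomorphic_two_elements (R : nzSemiRingType) :
  semiring_isomorphic R boolean_semifield -> forall x : R, x = 0 \/ x = 1.
Proof.
move=> [f /bij_inj f_inj] x; case fx: (f x); [right | left]; apply: f_inj.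
  by rewrite rmorph1.
by rewrite rmorph0.
Qed.

Theorem theorem6p7 (d : Order.disp_t) (R : latticeOrderedSemiRingType d) :
  [<-> congruence_simple R;
       simple_semiring R;
       semiring_isomorphic R boolean_semifield].
Proof.
tfae=> [simR | [_ simR] | isoR].
- by split=> //; apply/two_elements_ideal_simple/congruence_simple_two_elements.
(* That 1 is the top element gives [1 + 1 = 1]. *)
- apply: two_elements_isomorphic; last exact: addr1_top.
  exact: congruence_simple_two_elements.
- exact/two_elements_congruence_simple/isomorphic_two_elements.
Qed.
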